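(* Let $f: M \to N$ be a smooth $G$-equivariant map between $G$-manifolds. Choose $\mu \in N$ such that $f^{-1}(\mu)$ is not empty. Assume that the stabilizer subgroup $G_\mu$ of $\mu$ is a Lie subgroup of $G$. If $f$ can be brought into an equivariant normal form at every point of $f^{-1}(\mu)$, then there exists a Kuranishi chart on the quotient space $\check{M}_\mu = f^{-1}(\mu) / G_\mu$ at every point.
   Context: Lie groups and manifolds are smooth and modeled on (possibly infinite-dimensional) locally convex spaces. A $G$-manifold is a manifold with smooth $G$-action. $G_m$ denotes the stabilizer of $m$; for $\mu=f(m)$, $G_m\subseteq G_\mu$. The space $\check M_\mu$ carries the quotient of the subspace topology. Kuranishi chart: for a topological space $\mathscr{X}$, a Kuranishi chart at $x\in\mathscr{X}$ is a tuple $(V,E,F,H,s,\kappa)$ with $V$ an open neighborhood of $0$ in a locally convex space $E$; $F$ a locally convex space; $H$ a compact Lie group acting linearly and continuously on $V$ (i.e. on $E$, leaving $V$ invariant) and on $F$; $s:V\to F$ a smooth $H$-equivariant map; and $\kappa$ a homeomorphism from $s^{-1}(0)/H$ to a neighborhood of $x$ in $\mathscr{X}$. Slice: let a Lie group $K$ act on $M$. A slice at $m$ is a submanifold $S \ni m$ of $M$ with: (SL1) $K_m\cdot S \subseteq S$; (SL2) if $(g\cdot S)\cap S\neq\emptyset$ then $g\in K_m$; (SL3) $K_m$ is a Lie subgroup of $K$ for which $K\to K/K_m$ is a principal bundle, and this bundle admits a local section $\chi: K/K_m\supseteq W\to K$ on an open neighborhood $W$ of $[e]$ such that $W\times S\to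 M$, $([g],s)\mapsto \chi([g])\cdot s$ is a diffeomorphism onto an open neighborhood of $m$; (SL4) $\{s\in S: K_s \text{ conjugate to } K_m\}$ is a closed submanifold of $S$; (SL5) there are a smooth representation of $K_m$ on a locally convex space $X$ and a $K_m$-equivariant diffeomorphism from a $K_m$-invariant open neighborhood of $0$ in $X$ onto $S$ mapping $0$ to $m$. Equivariant normal form: a tuple $(H,X,Y,\hat f,f_{\mathrm{sing}})$ with $H$ a compact Lie group; $X,Y$ locally convex spaces with smooth linear $H$-actions and $H$-invariant topological decompositions $X=\mathrm{ker}\oplus\mathrm{coim}$, $Y=\mathrm{coker}\oplus\mathrm{im}$ (names of subspaces); $\hat f:\mathrm{coim}\to\mathrm{im}$ an $H$-equivariant linear topological isomorphism; $f_{\mathrm{sing}}:X\supseteq U\to\mathrm{coker}$ a smooth $H$-equivariant map on an $H$-invariant open neighborhood $U$ of $0$ with $f_{\mathrm{sing}}(0,x_2)=0$ for $x_2\in U\cap\mathrm{coim}$ and $T_{(0,0)}f_{\mathrm{sing}}=0$. $f$ can be brought into this equivariant normal form at $m$ (with $\mu=f(m)$) if $H=G_m$ and there exist a slice $S$ at $m$ for the $G_\mu$-action, a $G_m$-equivariant diffeomorphism $\iota_S:X\supseteq U\to S$ (with $\iota_S(0)=m$), and a $G_m$-equivariant chart $\rho:N\supseteq V'\to V\subseteq Y$ with $\rho(\mu)=0$ and $f(S)\subseteq V'$ such that $f(\chi^T([g,\iota_S(x)]))=\rho^T([g,\hat f(x_2)+f_{\mathrm{sing}}(x_1,x_2)])$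 for all $g\in G_\mu$, $x=(x_1,x_2)\in U$, where $\chi^T:G_\mu\times_{G_m}S\to M$, $[g,s]\mapsto g\cdot s$, and $\rho^T:G_\mu\times_{G_m}V\to N$, $[g,y]\mapsto g\cdot\rho^{-1}(y)$. It can be brought into an equivariant normal form at $m$ if this holds for some such tuple. *)

(* Defs.v *)
From HB Require Import structures.
From mathcomp Require Import all_boot all_order all_algebra.
From mathcomp Require Import all_classical all_reals all_analysis.
Set Implicit Arguments.
Unset Strict Implicit.
Unset Printing Implicit Defensive.
Import Order.TTheory GRing.Theory Num.Theory.
Import numFieldNormedType.Exports.
Local Open Scope classical_set_scope.
Local Open Scope ring_scope.

(* Locally convex spaces are objects of [tvsType R].  As usual in infinite
   dimensional differential geometry, they and all manifolds are Hausdorff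
   (this is required separately, since [tvsType] does not include it). *)

(* Calculus in the sense of Michal-Bastiani (Keller's C^k_c). *)
Section Calculus.
Variable R : realType.

Definition dir_derivative (E F : tvsType R) (f : E -> F) (x v : E) (l : F) :=
  t^-1 *: (f (x + t *: v) - f x) @[t --> (0 : R)^'] --> l.

(* C^{k+1}: the differential (x, v) |-> df(x; v) exists on U x E and is C^k. *)
Fixpoint Ck (k : nat) (E F : tvsType R) (U : set E) (f : E -> F) : Prop :=
  match k with
  | 0%N => {within U, continuous f}
  | k'.+1 => {within U, continuous f} /\
      exists df : (E * E)%type -> F,
        (forall x v, U x -> dir_derivative f x v (df (x, v))) /\
        Ck k' (U `*` [set: E]) df
  end.

Definition smooth_on (E F : tvsType R) (U : set E) (f : E -> F) :=
  forall k, Ck k U f.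

Definition closed_linear_embedding (F E : tvsType R) (j : F -> E) :=
  [/\ linear j, injective j, closed (range j), continuous j &
      forall O, open O -> exists2 O', open O' & O = j @^-1` O'].

End Calculus.

(* A partial bijection between dom in T and img in a locally convex space; only
   the values of cmap on dom and of cinv on img are meaningful. *)
Record chart (R : realType) (T : Type) := Chart {
  model : tvsType R;
  dom : set T;
  img : set model;
  cmap : T -> model;
  cinv : model -> T }.
Arguments Chart {R T model}.
Arguments dom {R T} c _.
Arguments img {R T} c _.
Arguments cmap {R T} c _.
Arguments cinv {R T} c _.

(* A subset carrier of an ambient space, with a set of charts on it.  This lets us
   treat manifolds, their open subsets, submanifolds and products uniformly. *)
Record mfd (R : realType) (T : Type) := Mfd {
  carrier : set T;
  mcharts : chart R T -> Prop }.
Arguments Mfd {R T}.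

Section Manifolds.
Variable R : realType.

Definition is_chart (T : topologicalType) (D : set T) (c : chart R T) :=
  [/\ hausdorff_space (model c),
      (exists2 O, open O & dom c = D `&` O) /\ open (img c),
      set_fun (dom c) (img c) (cmap c) /\ set_fun (img c) (dom c) (cinv c),
      {in dom c, cancel (cmap c) (cinv c)} /\
        {in img c, cancel (cinv c) (cmap c)} &
      {within dom c, continuous (cmap c)} /\
        {within img c, continuous (cinv c)}].

Definition smooth_transition (T : topologicalType) (c d : chart R T) :=
  smooth_on (img c `&` cinv c @^-1` dom d) (cmap d \o cinv c).

Definition compatible (T : topologicalType) (c d : chart R T) :=
  smooth_transition c d /\ smooth_transition d c.

(* The models of different charts may differ. *)
Definition is_atlas (T : topologicalType) (X : mfd R T) :=
  [/\ (forall c, mcharts X c -> is_chart (carrier X) c),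
      (forall x, carrier X x -> exists2 c, mcharts X c & dom c x) &
      forall c d, mcharts X c -> mcharts X d -> compatible c d].

Definition max_charts (T : topologicalType) (X : mfd R T) (c : chart R T) :=
  is_chart (carrier X) c /\ forall d, mcharts X d -> compatible c d.

Definition smooth_map (T T' : topologicalType) (X : mfd R T) (Y : mfd R T')
    (f : T -> T') :=
  [/\ set_fun (carrier X) (carrier Y) f,
      {within carrier X, continuous f} &
      forall c d, mcharts X c -> mcharts Y d ->
        smooth_on (img c `&` (f \o cinv c) @^-1` dom d)
                  (cmap d \o f \o cinv c)].

Definition diffeo (T T' : topologicalType) (X : mfd R T) (Y : mfd R T')
    (f : T -> T') :=
  smooth_map X Y f /\
  exists g : T' -> T, [/\ smooth_map Y X g,
    {in carrier X, cancel f g} & {in carrier Y, cancel g f}].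

(* An open subset of a locally convex space. *)
Definition mfd_lcs (E : tvsType R) (U : set E) : mfd R E :=
  Mfd U (fun c => c = Chart U U id id).

Definition mfd_open (T : Type) (X : mfd R T) (O : set T) : mfd R T :=
  Mfd (carrier X `&` O)
    (fun c' => exists2 c, mcharts X c & c' =
       Chart (dom c `&` O) (img c `&` cinv c @^-1` O) (cmap c) (cinv c)).

Definition prod_chart (T T' : Type) (c : chart R T) (d : chart R T') :
    chart R (T * T') :=
  @Chart R (T * T')%type (model c * model d)%type
    (dom c `*` dom d) (img c `*` img d)
    (fun p => (cmap c p.1, cmap d p.2)) (fun q => (cinv c q.1, cinv d q.2)).

Definition mfd_prod (T T' : Type) (X : mfd R T) (Y : mfd R T') :
    mfd R (T * T') :=
  Mfd (carrier X `*` carrier Y)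
    (fun b => exists c d, [/\ mcharts X c, mcharts Y d & b = prod_chart c d]).

(* Submanifolds: locally, in a chart phi of the maximal atlas, S is the trace
   of a closed linear subspace, given here as the range of a closed linear
   embedding j; the charts of S are the restrictions of such phi.  The subspace
   need not be complemented. *)
Definition sub_charts (T : topologicalType) (X : mfd R T) (S : set T)
    (c : chart R T) : Prop :=
  exists (phi : chart R T) (j : model c -> model phi),
     [/\ max_charts X phi, closed_linear_embedding j,
         dom c = dom phi `&` S /\ img c = j @^-1` img phi,
         cmap phi @` dom c = img phi `&` range j &
         (forall x, dom c x -> j (cmap c x) = cmap phi x) /\
         (forall y, img c y -> cinv c y = cinv phi (j y))].

Definition mfd_sub (T : topologicalType) (X : mfd R T) (S : set T) : mfd R T :=
  Mfd S (sub_charts X S).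

Definition submanifold (T : topologicalType) (X : mfd R T) (S : set T) :=
  S `<=` carrier X /\ forall x, S x -> exists2 c, sub_charts X S c & dom c x.

Definition closed_submanifold (T : topologicalType) (X : mfd R T) (S : set T) :=
  submanifold X S /\ exists2 C, closed C & S = carrier X `&` C.

End Manifolds.

HB.mixin Record isManifold (R : realType) M & Topological M := {
  atlas : chart R M -> Prop;
  manifold_hausdorff : hausdorff_space M;
  atlasP : is_atlas (Mfd [set: M] atlas) }.

#[short(type="manifoldType")]
HB.structure Definition Manifold (R : realType) :=
  {M of isManifold R M & Topological M}.

Definition whole (R : realType) (M : manifoldType R) : mfd R M :=
  Mfd [set: M] atlas.
Arguments whole {R} M.

HB.mixin Record isLieGroup (R : realType) G & Manifold R G & Group G := {
  mul_smooth : smooth_map (mfd_prod (whole G) (whole G)) (whole G)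
                 (fun p : G * G => (p.1 * p.2)%g);
  inv_smooth : smooth_map (whole G) (whole G) (fun g : G => g^-1%g) }.

#[short(type="lieGroupType")]
HB.structure Definition LieGroup (R : realType) :=
  {G of isLieGroup R G & Manifold R G & Group G}.

(* The quotient of the subspace A of T by the equivalence relation whose classes
   are the fibres of p; below, p x is always the orbit (or coset) of x. *)
Section Quotient.
Local Open Scope quotient_scope.
Variables (T : topologicalType) (Z : Type) (A : set T) (p : T -> Z).

Definition same_class (x y : set_type A) : bool := `[< p (\val x) = p (\val y) >].

Lemma same_class_equiv : equiv_class_of same_class.
Proof.
split=> [x|x y|y x z]; first exact/asboolP.
  by apply/asboolP/asboolP => ->.
by move=> /asboolP xy /asboolP yz; apply/asboolP; rewrite xy.
Qed.

Definition class_equiv : equiv_rel (set_type A) := EquivRelPack same_class_equiv.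

Definition quotient_space : topologicalType :=
  quotient_topology {eq_quot class_equiv}.

Definition to_class (x : set_type A) : quotient_space :=
  \pi_({eq_quot class_equiv}) x.

End Quotient.
Arguments quotient_space {T Z}.

Section Actions.
Variable R : realType.

(* Actions of a subgroup K of G; act need only be meaningful on K. *)
Definition is_action (G : groupType) (T : Type) (K : set G)
    (act : G -> T -> T) :=
  (forall x, act 1%g x = x) /\
  (forall g h x, K g -> K h -> act (g * h)%g x = act g (act h x)).

Definition is_linear_action (G : groupType) (E : tvsType R) (K : set G)
    (act : G -> E -> E) :=
  is_action K act /\ forall g, K g -> linear (act g).

Definition invariant_under (G T : Type) (K : set G) (act : G -> T -> T)
    (U : set T) := forall g x, K g -> U x -> U (act g x).

Definition smooth_G_action (G : lieGroupType R) (M : manifoldType R)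
    (act : G -> M -> M) :=
  is_action [set: G] act /\
  smooth_map (mfd_prod (whole G) (whole M)) (whole M)
    (fun p : G * M => act p.1 p.2).

Definition smooth_representation (G : lieGroupType R) (E : tvsType R)
    (K : mfd R G) (act : G -> E -> E) :=
  is_linear_action (carrier K) act /\
  smooth_map (mfd_prod K (mfd_lcs [set: E])) (mfd_lcs [set: E])
    (fun p : G * E => act p.1 p.2).

Definition orbit (G T : Type) (K : set G) (act : G -> T -> T) (x : T) : set T :=
  [set act g x | g in K].

Definition stabilizer (G T : Type) (K : set G) (act : G -> T -> T) (x : T) :
    set G := [set g | K g /\ act g x = x].

Definition lcoset_of (G : groupType) (H : set G) (g : G) : set G :=
  [set (g * h)%g | h in H].

Definition subgroup (G : groupType) (K : set G) :=
  [/\ K 1%g, (forall g h, K g -> K h -> K (g * h)%g) &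
      forall g, K g -> K g^-1%g].

Definition lie_subgroup (G : lieGroupType R) (X : mfd R G) (K : set G) :=
  subgroup K /\ submanifold X K.

End Actions.

Section PrincipalBundle.
Variables (R : realType) (G : lieGroupType R) (K H : set G).

Definition coset_space : topologicalType := quotient_space K (lcoset_of H).

Definition coset_preimage (O : set coset_space) : set G :=
  [set g | exists2 k : set_type K, \val k = g & O (to_class (lcoset_of H) k)].

Let mK := mfd_sub (whole G) K.
Let mH := mfd_sub mK H.

(* The manifold mQ on K/H makes K -> K/H a (right) principal H-bundle: it is
   locally trivial, with H-equivariant local trivializations. *)
Definition principal_bundle (mQ : mfd R coset_space) :=
  [/\ carrier mQ = setT, hausdorff_space coset_space, is_atlas mQ &
      forall q, exists (O : set coset_space)
                       (Phi : coset_space * G -> set_type K),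
        [/\ open O /\ O q,
            (forall r h, O r -> H h -> to_class (lcoset_of H) (Phi (r, h)) = r),
            (forall r h h', O r -> H h -> H h' ->
               \val (Phi (r, (h * h')%g)) = (\val (Phi (r, h)) * h')%g) &
            diffeo (mfd_prod (mfd_open mQ O) mH)
                   (mfd_open mK (coset_preimage O))
                   (fun p => \val (Phi p))]].

End PrincipalBundle.

Section Slice.
Variables (R : realType) (G : lieGroupType R) (M : manifoldType R).
Variables (act : G -> M -> M) (K : set G).

Let mK := mfd_sub (whole G) K.

(* A slice at m for the action of the Lie subgroup K of G.  The stabilizer K_m
   is a Lie subgroup of K, i.e. a submanifold of the submanifold K of G. *)
Definition slice (m : M) (S : set M) :=
  let Km := stabilizer K act m in
  let mKm := mfd_sub mK Km in
  let mS := mfd_sub (whole M) S in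
  [/\ S m /\ submanifold (whole M) S,
      invariant_under Km act S /\
        (forall g, K g -> act g @` S `&` S !=set0 -> Km g),
      lie_subgroup mK Km /\
      (exists mQ : mfd R (coset_space K Km),
        principal_bundle mQ /\
        exists (W : set (coset_space K Km))
               (chi : coset_space K Km -> set_type K) (O : set M),
          [/\ open W /\
                (exists2 e : set_type K, \val e = 1%g &
                   W (to_class (lcoset_of Km) e)),
              (forall w, W w -> to_class (lcoset_of Km) (chi w) = w),
              smooth_map (mfd_open mQ W) mK (fun w => \val (chi w)),
              open O /\ O m &
              diffeo (mfd_prod (mfd_open mQ W) mS) (mfd_open (whole M) O)
                     (fun p => act (\val (chi p.1)) p.2)]),
      closed_submanifold mS
        [set s | S s /\ exists2 k, K k &
           stabilizer K act s = [set (k * h * k^-1)%g | h in Km]] &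
      exists (X : tvsType R) (rep : G -> X -> X) (U : set X) (iota : X -> M),
        [/\ hausdorff_space X /\ smooth_representation mKm rep,
            [/\ open U, U 0 & invariant_under Km rep U],
            diffeo (mfd_lcs U) mS iota,
            iota 0 = m &
            forall g x, Km g -> U x -> iota (rep g x) = act g (iota x)]].

End Slice.

(* The decompositions X = ker (+) coim and Y = coker (+) im are external direct
   sums: X is ker * coim and Y is coker * im, with the product topologies and
   the componentwise actions of H. *)
Record normal_form (R : realType) := NormalForm {
  nH : lieGroupType R;
  nker : tvsType R;
  ncoim : tvsType R;
  ncoker : tvsType R;
  nim : tvsType R;
  act_ker : nH -> nker -> nker;
  act_coim : nH -> ncoim -> ncoim;
  act_coker : nH -> ncoker -> ncoker;
  act_im : nH -> nim -> nim;
  fhat : ncoim -> nim;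
  nU : set (nker * ncoim);
  fsing : nker * ncoim -> ncoker;
  nH_compact : compact [set: nH];
  nhausdorff : [/\ hausdorff_space nker, hausdorff_space ncoim,
                   hausdorff_space ncoker & hausdorff_space nim];
  nreps : [/\ smooth_representation (whole nH) act_ker,
              smooth_representation (whole nH) act_coim,
              smooth_representation (whole nH) act_coker &
              smooth_representation (whole nH) act_im];
  fhat_linear : linear fhat;
  fhat_homeo : continuous fhat /\
    exists g : nim -> ncoim, [/\ continuous g, cancel fhat g & cancel g fhat];
  fhat_equiv : forall h x, fhat (act_coim h x) = act_im h (fhat x);
  nU_open : open nU;
  nU0 : nU (0, 0);
  nU_invariant : forall h x1 x2,
    nU (x1, x2) -> nU (act_ker h x1, act_coim h x2);
  fsing_smooth : smooth_on nU fsing;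
  fsing_equiv : forall h x1 x2, nU (x1, x2) ->
    fsing (act_ker h x1, act_coim h x2) = act_coker h (fsing (x1, x2));
  fsing_coim : forall x2, nU (0, x2) -> fsing (0, x2) = 0;
  fsing_diff0 : forall v, dir_derivative fsing (0, 0) v 0 }.

Arguments nU {R} n _.

Section NormalFormAt.
Variables (R : realType) (G : lieGroupType R) (M N : manifoldType R).
Variables (actM : G -> M -> M) (actN : G -> N -> N) (f : M -> N).

(* The identification H = G_m of Lie groups is the isomorphism theta; G_m carries
   its Lie group structure as a Lie subgroup of G_mu.  The tube
   maps G_mu x_{G_m} S -> M and G_mu x_{G_m} V -> N are written on
   representatives, as [g, s] |-> g . s and [g, y] |-> g . rho^-1(y). *)
Definition brought_into (m : M) (nf : normal_form R) :=
  let Gmu := stabilizer [set: G] actN (f m) in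
  let Gm := stabilizer [set: G] actM m in
  let X := (nker nf * ncoim nf)%type in
  let Y := (ncoker nf * nim nf)%type in
  exists (theta : nH nf -> G) (S : set M) (iota : X -> M)
         (V' : set N) (V : set Y) (rho : N -> Y) (rhoi : Y -> N),
    [/\ {morph theta : g h / (g * h)%g} /\
          diffeo (whole (nH nf)) (mfd_sub (mfd_sub (whole G) Gmu) Gm) theta,
        slice actM Gmu m S,
        [/\ diffeo (mfd_lcs (nU nf)) (mfd_sub (whole M) S) iota,
            iota (0, 0) = m &
            forall h x1 x2, nU nf (x1, x2) ->
              iota (act_ker h x1, act_coim h x2)
                = actM (theta h) (iota (x1, x2))],
        [/\ max_charts (whole N) (Chart V' V rho rhoi),
            V' (f m) /\ rho (f m) = (0, 0),
            invariant_under Gm actN V',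
            (forall h n, V' n -> rho (actN (theta h) n)
               = (act_coker h (rho n).1, act_im h (rho n).2)) &
            f @` S `<=` V'] &
        forall g x1 x2, Gmu g -> nU nf (x1, x2) ->
          V (fsing (x1, x2), fhat x2) /\
          f (actM g (iota (x1, x2)))
            = actN g (rhoi (fsing (x1, x2), fhat x2))].

Definition has_normal_form_at (m : M) := exists nf, brought_into m nf.

(* f^-1(mu) / G_mu *)
Definition reduced_space (mu : N) : topologicalType :=
  quotient_space (f @^-1` [set mu])
    (orbit (stabilizer [set: G] actN mu) actM).

End NormalFormAt.

Definition zero_locus (R : realType) (E F : tvsType R) (V : set E)
    (s : E -> F) : set E := V `&` s @^-1` [set 0].

Record kuranishi_chart (R : realType) (X : topologicalType) (x : X) :=
  KuranishiChart {
  kE : tvsType R;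
  kF : tvsType R;
  kH : lieGroupType R;
  kV : set kE;
  actE : kH -> kE -> kE;
  actF : kH -> kF -> kF;
  ks : kE -> kF;
  kappa : quotient_space (zero_locus kV ks) (orbit [set: kH] actE) -> X;
  kE_hausdorff : hausdorff_space kE;
  kF_hausdorff : hausdorff_space kF;
  kH_compact : compact [set: kH];
  kV_open : open kV;
  kV0 : kV 0;
  actE_linear : is_linear_action [set: kH] actE;
  actE_continuous : continuous (fun p : kH * kE => actE p.1 p.2);
  actF_linear : is_linear_action [set: kH] actF;
  actF_continuous : continuous (fun p : kH * kF => actF p.1 p.2);
  kV_invariant : invariant_under [set: kH] actE kV;
  ks_smooth : smooth_on kV ks;
  ks_equiv : forall h v, kV v -> ks (actE h v) = actF h (ks v);
  kappa_nbhs : nbhs x (range kappa);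
  kappa_homeo : continuous kappa /\
    exists g, cancel kappa g /\ {within range kappa, continuous g} }.

(* Main.v *)
(* Since rho is injective, f (iota (x1, x2)) = mu exactly when fhat x2 = 0 and
   fsing (x1, x2) = 0, that is, when x2 = 0 and s x1 := fsing (x1, 0) vanishes.
   So s, defined on a neighbourhood of 0 in ker with values in coker, is a
   Kuranishi map, and x1 |-> iota (x1, 0) induces a continuous map
   s^-1(0) / G_m -> f^-1(mu) / G_mu.  It is injective because by (SL2) an element
   of G_mu moving a point of S into S lies in G_m; it is open because by (SL3)
   G_mu-saturations of relatively open subsets of S are open in M. *)

Require Import Defs.
From HB Require Import structures.
From mathcomp Require Import all_boot all_order all_algebra.
From mathcomp Require Import all_classical all_reals all_analysis.
Set Implicit Arguments.
Unset Strict Implicit.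
Unset Printing Implicit Defensive.
Import Order.TTheory GRing.Theory Num.Theory.
Import numFieldNormedType.Exports.
Local Open Scope classical_set_scope.
Local Open Scope ring_scope.

(* [orbit] alone would denote [fingraph.orbit]. *)
Local Notation orbit := Defs.orbit.

(** * Continuity on subsets, and C^k maps precomposed with linear maps *)

Lemma within_continuous_preimage (T T' : topologicalType) (A : set T)
    (f : T -> T') (O : set T') :
  {within A, continuous f} -> open O ->
  exists2 B, open B & forall x, A x -> B x <-> O (f x).
Proof.
move=> /continuousP cf /cf /open_subspaceP [B oB BA]; exists B => // x Ax.
by split=> [Bx|Ofx];
  [have [] : (f @^-1` O `&` A) x by rewrite -BA|
   have [] : (B `&` A) x by rewrite BA].
Qed.

Lemma within_continuous_comp (T1 T2 T3 : topologicalType) (A : set T2)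
    (f : T2 -> T3) (j : T1 -> T2) :
  continuous j -> {within A, continuous f} ->
  {within j @^-1` A, continuous (f \o j)}.
Proof.
move=> cj cf; apply/subspace_continuousP => x Ajx.
move/subspace_continuousP: cf => /(_ _ Ajx) cf.
apply: cvg_trans cf => O /= nO; rewrite /nbhs /= /within /= in nO *.
exact: cj nO.
Qed.

Lemma linear_map0 (R : realType) (E F : tvsType R) (j : E -> F) :
  linear j -> j 0 = 0.
Proof.
by move=> /(_ (-1) 0 0); rewrite scaler0 addr0 scaleN1r addNr.
Qed.

(** The differential of [f \o j] is [df] precomposed with j x j, which is again linear and
    continuous; hence the induction must range over all source spaces and all [j]. *)
Lemma Ck_comp_linear (R : realType) (k : nat) (E' E F : tvsType R) (U : set E)
    (f : E -> F) (j : E' -> E) :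
  linear j -> continuous j -> Ck k U f -> Ck k (j @^-1` U) (f \o j).
Proof.
elim: k => [|k IH] in E' E U f j *; move=> lj cj.
  exact: within_continuous_comp.
move=> [cf [df [dfP dfk]]]; split; first exact: within_continuous_comp.
exists (df \o (fun p : E' * E' => (j p.1, j p.2))); split => [x v Ujx|].
  rewrite /dir_derivative /=.
  have jD t : j (x + t *: v) = j x + t *: j v by rewrite addrC lj addrC.
  by under eq_fun do rewrite jD; exact: dfP.
have -> : (j @^-1` U) `*` [set: E'] =
    (fun p : E' * E' => (j p.1, j p.2)) @^-1` (U `*` [set: E]) by [].
apply: IH dfk => [a [u1 u2] [v1 v2]|[u v]]; first by rewrite /= !lj.
apply: cvg_pair => /=.
  exact: (cvg_comp (@fst E' E') j cvg_fst (cj u)).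
exact: (cvg_comp (@snd E' E') j cvg_snd (cj v)).
Qed.

(** * Quotients of subspaces and maps between them *)

Lemma to_classP (T : topologicalType) (Z : Type) (A : set T) (p : T -> Z)
    (x y : set_type A) :
  to_class p x = to_class p y <-> p (\val x) = p (\val y).
Proof.
split=> [/eqmodP /asboolP //|pxy]; apply/eqmodP; exact/asboolP.
Qed.

Lemma to_class_surj (T : topologicalType) (Z : Type) (A : set T) (p : T -> Z)
    (c : quotient_space A p) : exists x, to_class p x = c.
Proof. by exists (repr c); rewrite /to_class reprK. Qed.

(** The opens of [set_type A] are the traces of opens of [T], so openness in the quotient can be
    tested with ambient open sets. *)
Lemma open_quotient_space (T : topologicalType) (Z : Type) (A : set T)
    (p : T -> Z) (W : set (quotient_space A p)) :
  open W <-> exists2 O, open O &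
    forall x : set_type A, W (to_class p x) <-> O (\val x).
Proof.
split=> -[U oU OW]; exists U => //.
  by move=> x; have := congr1 (@^~ x) OW => /= ->.
by apply/seteqP; split=> x /OW.
Qed.

Section QuotientMap.
Variables (T T' : topologicalType) (Z Z' : Type) (A : set T) (B : set T').
Variables (p : T -> Z) (q : T' -> Z') (phi : T -> T').
Hypothesis phi_fun : set_fun A B phi.
Hypothesis phi_class :
  forall x y, A x -> A y -> p x = p y <-> q (phi x) = q (phi y).
Hypothesis phi_continuous : {within A, continuous phi}.
Hypothesis phi_saturation_open : forall O, open O -> exists2 O', open O' &
  forall b, B b -> O' b <-> exists2 a, (A `&` O) a & q b = q (phi a).

(** Read forwards, [phi_class] lets [phi] descend to classes; read backwards, it makes the descended
    map injective. By [phi_saturation_open] that map is also open, and a continuous open injection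
    is a homeomorphism onto its open range. *)
Lemma quotient_open_embedding : A !=set0 ->
  exists kappa : quotient_space A p -> quotient_space B q,
  [/\ (forall (a : set_type A) (b : set_type B),
         phi (\val a) = \val b -> kappa (to_class p a) = to_class q b),
      open (range kappa), continuous kappa &
      exists g, cancel kappa g /\ {within range kappa, continuous g}].
Proof.
case=> a0 Aa0.
pose phiS (a : set_type A) : set_type B :=
  SigSub (mem_set (phi_fun (set_valP a))).
pose kappa (c : quotient_space A p) : quotient_space B q :=
  to_class q (phiS (repr c)).
have kappaE a : kappa (to_class p a) = to_class q (phiS a).
  apply/to_classP/phi_class; try exact: set_valP.
  by apply/to_classP; rewrite /to_class reprK.
have kappa_inj : injective kappa.
  move=> c d; have [a <-] := to_class_surj c; have [b <-] := to_class_surj d.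
  rewrite !kappaE => /to_classP/phi_class pab; apply/to_classP.
  by apply: pab; exact: set_valP.
have kappa_open W : open W -> open (kappa @` W).
  move=> /open_quotient_space[U oU UW].
  have [V oV VP] := phi_saturation_open oU.
  apply/open_quotient_space; exists V => // b.
  rewrite (VP _ (set_valP b)); split.
    move=> [c]; have [a <-] := to_class_surj c => /UW Ua.
    rewrite kappaE => /to_classP /= qab; exists (\val a) => //.
    by split; [exact: set_valP|].
  move=> [a [Aa Ua] qab]; exists (to_class p (SigSub (mem_set Aa))).
    exact/UW.
  by rewrite kappaE; apply/to_classP.
exists kappa; split.
- by move=> a b ab; rewrite kappaE; apply/to_classP; rewrite /= ab.
- exact: kappa_open openT.
- apply/continuousP => W /open_quotient_space[U oU UW].
  have [C oC CP] := within_continuous_preimage phi_continuous oU.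
  apply/open_quotient_space; exists C => // a.
  by rewrite (CP _ (set_valP a)) /= kappaE UW.
(* A default value for [g] outside the range of [kappa]. *)
pose c0 : quotient_space A p := to_class p (SigSub (mem_set Aa0)).
pose g y := if pselect (exists c, kappa c = y) is left h
            then projT1 (cid h) else c0.
have kappaK : cancel kappa g.
  move=> c; rewrite /g; case: pselect => [h|[]]; last by exists c.
  by apply: kappa_inj; exact: (projT2 (cid h)).
exists g; split=> //; clearbody g.
apply/continuousP => W oW; apply/open_subspaceP.
(* On the range of [kappa], the preimage of [W] under [g] is the image of [W] under [kappa]. *)
exists (kappa @` W); first exact: kappa_open.
apply/seteqP; split=> y [].
  by case=> c Wc <- _; split; [rewrite /= /from_subspace kappaK|exists c].
by move=> + [c _ cy]; rewrite /= -cy /from_subspace kappaK => Wc; split; exists c.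
Qed.

End QuotientMap.

(** * Group actions and slices *)

Lemma orbit_eqP (G : groupType) (T : Type) (K : set G) (act : G -> T -> T)
    (x y : T) : subgroup K -> is_action K act ->
  orbit K act x = orbit K act y <-> exists2 g, K g & x = act g y.
Proof.
move=> [K1 KM KV] [a1 aM]; split=> [xy|[g Kg ->]].
  have : orbit K act x x by exists 1%g.
  by rewrite xy => -[g Kg <-]; exists g.
apply/seteqP; split=> _ [h Kh <-].
  by exists (h * g)%g; [exact: KM|rewrite aM].
have Kg' := KV _ Kg; exists (h * g^-1)%g; first exact: KM.
by rewrite aM//; congr (act h); rewrite -aM// mulVg a1.
Qed.

Lemma is_action_sub (G : groupType) (T : Type) (K : set G)
    (act : G -> T -> T) : is_action [set: G] act -> is_action K act.
Proof. by move=> [a1 aM]; split=> // *; exact: aM. Qed.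

Lemma subgroup_stabilizer (G : groupType) (T : Type) (act : G -> T -> T)
    (x : T) : is_action [set: G] act -> subgroup (stabilizer [set: G] act x).
Proof.
move=> [a1 aM]; split=> [|g h [_ gx] [_ hx]|g [_ gx]]; split=> //.
  by rewrite aM// hx.
by rewrite -{1}gx -aM// mulVg.
Qed.

Lemma within_setT_continuous (T T' : topologicalType) (f : T -> T') :
  {within setT, continuous f} -> continuous f.
Proof. by move=> cf; apply/continuous_subspace_setT. Qed.

Lemma smooth_G_action_continuous (R : realType) (G : lieGroupType R)
    (M : manifoldType R) (act : G -> M -> M) (g : G) :
  smooth_G_action act -> continuous (act g).
Proof.
move=> [_ [_ + _]]; rewrite /= setXTT => /within_setT_continuous ca y.
exact: (cvg_comp2 (cvg_cst g) cvg_id (ca (g, y))).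
Qed.

Lemma smooth_representation_continuous (R : realType) (G : lieGroupType R)
    (E : tvsType R) (act : G -> E -> E) :
  smooth_representation (whole G) act ->
  continuous (fun p : G * E => act p.1 p.2).
Proof. by move=> [_ [_ + _]]; rewrite /= setXTT => /within_setT_continuous. Qed.

(* The saturation is the union of the translates of [chi(W) . (S `&` B)], which is
   open because the tube map is a homeomorphism. *)
Lemma slice_saturation_open (R : realType) (G : lieGroupType R)
    (M : manifoldType R) (act : G -> M -> M) (K : set G) (m : M)
    (S B : set M) :
  smooth_G_action act -> subgroup K -> slice act K m S -> open B ->
  exists2 O, open O & forall y, O y <->
    exists2 s, (S `&` B) s & orbit K act y = orbit K act s.
Proof.
move=> act_smooth K_subgroup.
have [K1 KM KV] := K_subgroup; have [aP _] := act_smooth.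
have [a1 aM] := aP.
move=> [_ _ [_ [mQ [[mQT _ _ _] tube]]] _ _] oB.
have [W [chi [Q [[oW [e e1 We]] chiP _ [oQ Qm] tube_diffeo]]]] := tube.
have {tube_diffeo} [[tube_fun _ _] [Psi [[Psi_fun Psi_cont _] tubeK PsiK]]] := tube_diffeo.
have oB2 : open [set p : coset_space K (stabilizer K act m) * M | B p.2].
  by apply: open_comp oB => p _; exact: cvg_snd.
(* As [Psi] inverts the tube map, the part of [C] inside [Q] is exactly chi(W) . (S cap B). *)
have [C oC CP] := within_continuous_preimage Psi_cont oB2.
pose D := \bigcup_(g in K) (act g @^-1` (Q `&` C)).
have oD : open D.
  apply: bigcup_open => g _; apply: open_comp (openI oQ oC) => y _.
  exact: smooth_G_action_continuous.
exists D => // y; split.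
  move=> [g Kg [Qy Cy]].
  have Py : carrier (mfd_open (whole M) Q) (act g y) by [].
  have [[_ _] Sy] := Psi_fun _ Py.
  have By := (CP _ Py).1 Cy.
  exists (Psi (act g y)).2 => //; apply/(orbit_eqP _ _ K_subgroup).
    exact: is_action_sub.
  have Kchi := set_valP (chi (Psi (act g y)).1).
  (* Writing (w, s) for [Psi (act g y)], the tube map gives g y = chi(w) s. *)
  exists (g^-1 * \val (chi (Psi (act g y)).1))%g; first exact/KM/Kchi/KV.
  have Ey := PsiK _ (mem_set Py); rewrite /= in Ey.
  by rewrite aM// Ey -aM// mulVg a1.
move=> [s [Ss Bs]] /(orbit_eqP _ _ K_subgroup (is_action_sub _ aP)) [g Kg ->].
pose w := to_class (lcoset_of (stabilizer K act m)) e.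
have Pw : carrier (mfd_prod (mfd_open mQ W) (mfd_sub (whole M) S)) (w, s).
  by split=> //; split=> //=; rewrite mQT.
have Kchi := set_valP (chi w).
(* Here chi([e]) lies in G_m but need not be the unit; this element carries y = g s to chi([e]) s,
   the tube image of ([e], s). *)
exists (\val (chi w) * g^-1)%g; first exact/KM/KV.
rewrite /= -aM// -mulgA mulVg mulg1.
have Pws := tube_fun _ Pw; split; first exact: Pws.2.
by apply/(CP _ Pws); have := tubeK _ (mem_set Pw) => /= ->.
Qed.

(** * The Kuranishi chart at a point of the reduced space *)

Theorem theorem5p3 (R : realType) (G : lieGroupType R) (M N : manifoldType R)
    (actM : G -> M -> M) (actN : G -> N -> N)
    (hactM : smooth_G_action actM) (hactN : smooth_G_action actN)
    (f : M -> N) (f_smooth : smooth_map (whole M) (whole N) f)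
    (f_equiv : forall (g : G) (m : M), f (actM g m) = actN g (f m))
    (mu : N) (f_mu : f @^-1` [set mu] !=set0)
    (Gmu_lie : lie_subgroup (whole G) (stabilizer [set: G] actN mu))
    (f_nf : forall m : M, f m = mu -> has_normal_form_at actM actN f m) :
  forall x : reduced_space actM actN f mu, inhabited (kuranishi_chart R x).
Proof.
move=> x; have [a <-] := to_class_surj x.
set m := \val a; have fm : f m = mu := set_valP a.
have [nf [theta [S [iota [V' [V [rho [rhoi]]]]]]]] := f_nf m fm.
have [aM _] := hactM; have [aN _] := hactN.
have [aM1 aMM] := aM.
rewrite fm; set K := stabilizer [set: G] actN mu.
move=> [[_ theta_diffeo] mS [iota_diffeo iota0 iota_equiv]
  [[rho_chart _] [V'mu rho_mu] _ _ _] f_iota].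
have K_subgroup : subgroup K by exact: subgroup_stabilizer.
have [[Sm _] [_ SL2] _ _ _] := mS.
have [[theta_fun _ _] [thetai [[thetai_fun _ _] _ thetaiK]]] := theta_diffeo.
have [[iota_fun iota_cont _] [iotai [[iotai_fun iotai_cont _] iotaK iotaiK]]] :=
  iota_diffeo.
have [rker rcoim rcoker _] := nreps nf.
have [hker _ hcoker _] := nhausdorff nf.
have [_ _ _ [rhoK rhoiK] _] := rho_chart.
have rhoi0 : rhoi (0, 0) = mu by rewrite -rho_mu; exact: (rhoK _ (mem_set V'mu)).
have fhat0 : fhat (0 : ncoim nf) = 0.
  exact/linear_map0/fhat_linear.
have [_ [fhatV [_ fhatK _]]] := @fhat_homeo _ nf.
have coim0 h : act_coim h 0 = 0 :> ncoim nf.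
  by have [[_ lcoim] _] := rcoim; exact/linear_map0/lcoim.
have f_level x1 x2 : nU nf (x1, x2) ->
    f (iota (x1, x2)) = mu <-> fsing (x1, x2) = 0 /\ x2 = 0.
  (* The normal form is evaluated at g = 1. *)
  move=> Ux; have [K1 _ _] := K_subgroup.
  have [Vx fx] := f_iota _ _ _ K1 Ux.
  have aN1 y : actN 1%g y = y by case: aN.
  rewrite aM1 aN1 in fx; rewrite fx; split=> [rx|[-> ->]]; last by rewrite fhat0.
  have := rhoiK _ (mem_set Vx); rewrite /= rx rho_mu => -[<- fx0].
  by split=> //; apply: (can_inj fhatK); rewrite -fx0 fhat0.
pose incl (x1 : nker nf) : nker nf * ncoim nf := (x1, 0).
have incl_linear : linear incl.
  by move=> k u v; rewrite /incl; congr pair; rewrite /= scaler0 addr0.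
have incl_continuous : continuous incl.
  by move=> u; apply: cvg_pair; [exact: cvg_id|exact: cvg_cst].
pose kV := incl @^-1` nU nf; pose ks := @fsing _ nf \o incl.
pose phi := iota \o incl.
pose p := orbit [set: nH nf] (@act_ker _ nf).
have phi_fun : set_fun (zero_locus kV ks) (f @^-1` [set mu]) phi.
  by move=> x1 [Ux sx]; apply/f_level.
have nH_subgroup : subgroup [set: nH nf] by [].
have ker_action : is_action [set: nH nf] (@act_ker _ nf) by case: rker => [[]].
have phi_equiv h x1 : kV x1 -> phi (act_ker h x1) = actM (theta h) (phi x1).
  by move=> Ux; rewrite /phi /= /incl -iota_equiv// coim0.
have phi_class x1 y1 : zero_locus kV ks x1 -> zero_locus kV ks y1 ->
    p x1 = p y1 <-> orbit K actM (phi x1) = orbit K actM (phi y1).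
  move=> [Ux sx] [Uy sy]; rewrite (orbit_eqP _ _ nH_subgroup)//.
  rewrite (orbit_eqP _ _ K_subgroup (is_action_sub _ aM)); split=> -[g Kg].
    move=> ->; exists (theta g); last exact: phi_equiv.
    (* An element fixing m also fixes mu = f(m), by equivariance of [f]. *)
    by have [_ gm] := theta_fun g I; split=> //; rewrite -fm -f_equiv gm.
  move=> xy; have [_ gm] : stabilizer K actM m g.
    apply: SL2 => //; exists (phi x1); split; last exact: iota_fun.
    by exists (phi y1) => //; exact: iota_fun.
  (* Now g is [theta] of h = [thetai g], so iota(x1, 0) = iota(h y1, 0); applying [iotai] yields x1
     = h y1, once (h y1, 0) is known to lie in the domain of [iota]. *)
  have Gm : stabilizer [set: G] actM m g by [].
  exists (thetai g) => //.
  have := phi_equiv (thetai g) _ Uy; rewrite (thetaiK g (mem_set Gm)) -xy.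
  move=> /(congr1 iotai).
  have Uhy : nU nf (act_ker (thetai g) y1, 0).
    by rewrite -(coim0 (thetai g)); exact: nU_invariant.
  by rewrite /phi /= !iotaK ?inE// => -[].
have phi_continuous : {within zero_locus kV ks, continuous phi}.
  apply: continuous_subspaceW (within_continuous_comp incl_continuous iota_cont).
  by move=> x1 [].
have phi_saturation (O : set (nker nf)) : open O -> exists2 O', open O' &
    forall b, (f @^-1` [set mu]) b -> O' b <->
      exists2 x1, (zero_locus kV ks `&` O) x1 &
        orbit K actM b = orbit K actM (phi x1).
  move=> oO; have oO1 : open [set y : nker nf * ncoim nf | O y.1].
    by apply: open_comp oO => y _; exact: cvg_fst.
  (* [B] cuts out of [S] the points whose ker-coordinate lies in [O], whatever their
     coim-coordinate. *)
  have [B oB BP] := within_continuous_preimage iotai_cont oO1.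
  have [P oP PP] := slice_saturation_open hactM K_subgroup mS oB.
  exists P => // b fb; rewrite PP; split.
    move=> [s [Ss Bs] bs]; have Us := iotai_fun _ Ss.
    have Ob := (BP _ Ss).1 Bs.
    have sE := iotaiK _ (mem_set Ss).
    (* Since [K] fixes mu, the fibre is saturated: s lies in it along with b. Then [f_level] forces
       the coim-coordinate of s to vanish. *)
    have fs : f s = mu.
      have [g [_ gmu] bg] :=
        (orbit_eqP _ _ K_subgroup (is_action_sub _ aM)).1 (esym bs).
      by rewrite bg f_equiv fb.
    move: Us Ob sE; case: (iotai s) => x1 x2 Ux /= Ox1 sE.
    have [sx x20] : fsing (x1, x2) = 0 /\ x2 = 0.
      by apply/f_level => //; rewrite sE.
    by subst x2; exists x1; [split|rewrite bs -sE].
  move=> [x1 [[Ux sx] Ox] bx]; have Sx : S (phi x1) by exact: iota_fun.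
  exists (phi x1) => //; split=> //; apply/(BP _ Sx).
  by rewrite /= /phi /= iotaK// inE.
have Z0 : zero_locus kV ks 0.
  by split; [exact: nU0|apply: fsing_coim; exact: nU0].
have [kappa [kappaE kappa_open kappa_continuous kappa_inv]] :=
  quotient_open_embedding phi_fun phi_class phi_continuous phi_saturation
    (ex_intro _ 0 Z0).
constructor; apply: (@KuranishiChart _ _ _ (nker nf) (ncoker nf) (nH nf) kV
  (@act_ker _ nf) (@act_coker _ nf) ks kappa) => //.
- exact: nH_compact.
- by apply: (@open_comp _ _ incl) => [y _|]; [exact: incl_continuous|exact: nU_open].
- exact: Z0.1.
- by case: rker.
- exact: smooth_representation_continuous.
- by case: rcoker.
- exact: smooth_representation_continuous.
- by move=> h x1 _ Ux; rewrite /kV /incl /= -(coim0 h); exact: nU_invariant.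
- by move=> k; apply: Ck_comp_linear => //; exact: fsing_smooth.
- by move=> h x1 Ux; rewrite /ks /incl /= -fsing_equiv// coim0.
(* The open range of [kappa] contains the given point, namely as the value at the class of 0,
   because iota(0, 0) = m. *)
- apply: open_nbhs_nbhs; split=> //; exists (to_class p (SigSub (mem_set Z0))) => //.
  by apply: kappaE; exact: iota0.
Qed.
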